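(* For every integer $n\geq0$, $$\sum_{k=0}^{n}(-1)^{k}{2n+1\brack 2k}(-q;q)_{2n-2k}\,\widetilde T_{2k+1}(q)=(-1)^nT_{2n+1}(q),$$ where $\widetilde T_{1}(q)=1$ and, for $k\geq1$, $$\widetilde T_{2k+1}(q)=\sum_{i=0}^{k-1} {2k\brack 2i+1} T_{2i + 1}(q)\, T_{2k - 2i - 1}(q).$$
   Context: For a nonnegative integer $m$, $(t;q)_m=\prod_{i=0}^{m-1}(1-tq^i)$; in particular $(-q;q)_m=(1+q)(1+q^2)\cdots(1+q^m)$. The $q$-binomial coefficient is ${m\brack j}=\frac{(q;q)_m}{(q;q)_{m-j}(q;q)_j}$ for $0\le j\le m$. The $q$-sine and $q$-cosine are $\sin_q(x)=\sum_{m\geq0}(-1)^m\frac{x^{2m+1}}{(q;q)_{2m+1}}$ and $\cos_q(x)=\sum_{m\geq0}(-1)^m\frac{x^{2m}}{(q;q)_{2m}}$, and the $q$-tangent numbers $T_{2m+1}(q)$ are defined by $\frac{\sin_q(x)}{\cos_q(x)}=\sum_{m\geq0}T_{2m+1}(q)\frac{x^{2m+1}}{(q;q)_{2m+1}}$. (Equivalently, $T_{2m+1}(q)=\sum_{\pi}q^{\mathsf{inv}(\pi)}$ over down-up permutations $\pi_1>\pi_2<\pi_3>\cdots$ of $[2m+1]$, where $\mathsf{inv}$ is the number of inversions.) *)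

(* Defs.v *)
From mathcomp Require Import all_boot all_order all_algebra.
Set Implicit Arguments.
Unset Strict Implicit.
Unset Printing Implicit Defensive.
Import GRing.Theory.
Local Open Scope ring_scope.

(* A formal power series in x over F is its sequence of coefficients. *)
Definition fps (F : fieldType) := nat -> F.

Definition fps_mul (F : fieldType) (f g : fps F) : fps F :=
  fun n => \sum_(i < n.+1) f i * g (n - i)%N.

(* First n coefficients of 1 / f, by solving f * (1 / f) = 1 degree by degree;
   meaningful when f 0 != 0. *)
Fixpoint fps_inv_seq (F : fieldType) (f : fps F) (n : nat) : seq F :=
  if n is m.+1 then
    let s := fps_inv_seq f m in
    rcons s (((m == 0%N)%:R - \sum_(i < m) f (m - i)%N * s`_i) / f 0%N)
  else [::].

Definition fps_inv (F : fieldType) (f : fps F) : fps F :=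
  fun n => (fps_inv_seq f n.+1)`_n.

Definition fps_div (F : fieldType) (f g : fps F) : fps F :=
  fps_mul f (fps_inv g).

Definition qpoch (F : fieldType) (t q : F) (m : nat) : F :=
  \prod_(i < m) (1 - t * q ^+ i).

(* Only meaningful for j <= m. *)
Definition qbinom (F : fieldType) (q : F) (m j : nat) : F :=
  qpoch q q m / (qpoch q q (m - j) * qpoch q q j).

Definition qsin (F : fieldType) (q : F) : fps F :=
  fun n => if odd n then (-1) ^+ n./2 / qpoch q q n else 0.

Definition qcos (F : fieldType) (q : F) : fps F :=
  fun n => if odd n then 0 else (-1) ^+ n./2 / qpoch q q n.

(* qtangent q m is T_{2m+1}(q); see qtangentP for the generating function. *)
Definition qtangent (F : fieldType) (q : F) (m : nat) : F :=
  fps_div (qsin q) (qcos q) (2 * m).+1%N * qpoch q q (2 * m).+1.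

(* qtangent_tilde q k is the number \tilde T_{2k+1}(q);
   note that 2k - 2i - 1 = 2(k - i - 1) + 1. *)
Definition qtangent_tilde (F : fieldType) (q : F) (k : nat) : F :=
  if k == 0%N then 1 else
  \sum_(i < k) qbinom q (2 * k) (2 * i).+1
                 * qtangent q i * qtangent q (k - i - 1).

Section Facts.
Variable F : fieldType.
Implicit Types (f g : fps F) (q : F).

Lemma size_fps_inv_seq f n : size (fps_inv_seq f n) = n.
Proof. by elim: n => //= n IHn; rewrite size_rcons IHn. Qed.

Lemma nth_fps_inv_seq f n i : (i < n)%N -> (fps_inv_seq f n)`_i = fps_inv f i.
Proof.
elim: n => // n IHn; rewrite ltnS leq_eqVlt => /orP[/eqP-> // | lt_in].
by rewrite /= nth_rcons size_fps_inv_seq lt_in IHn.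
Qed.

Lemma fps_invE f n :
  fps_inv f n =
    ((n == 0%N)%:R - \sum_(i < n) f (n - i)%N * fps_inv f i) / f 0%N.
Proof.
rewrite {1}/fps_inv /= nth_rcons size_fps_inv_seq ltnn eqxx.
by under eq_bigr => i _ do rewrite nth_fps_inv_seq //.
Qed.

Lemma fps_mulVf f n : f 0%N != 0 -> fps_mul (fps_inv f) f n = (n == 0%N)%:R.
Proof.
move=> f0; rewrite /fps_mul big_ord_recr /= subnn [fps_inv f n]fps_invE divfK //.
by rewrite addrC -[RHS]addr0 -addrA; congr (_ + _); rewrite addrC;
   apply/eqP; rewrite subr_eq0; apply/eqP; apply: eq_bigr => i _; rewrite mulrC.
Qed.

Lemma qpoch_neq0 q m :
  (forall i, (0 < i)%N -> q ^+ i != 1) -> qpoch q q m != 0.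
Proof.
move=> hq; apply/prodf_neq0 => i _.
by rewrite -exprS subr_eq0 eq_sym hq.
Qed.

Lemma fps_inv_qcos_odd q n : odd n -> fps_inv (qcos q) n = 0.
Proof.
have [m] := ubnP n; elim: m n => // m IHm n; rewrite ltnS => le_nm n_odd.
rewrite fps_invE big1 => [|i _]; first by case: n n_odd {le_nm} => // n _; rewrite subr0 mul0r.
rewrite /qcos oddB 1?ltnW // n_odd /=; case: ifPn => [_|]; first by rewrite mul0r.
by rewrite negbK => i_odd; rewrite IHm ?mulr0 // (leq_trans _ le_nm).
Qed.

Lemma qtangentP q n :
  (forall i, (0 < i)%N -> q ^+ i != 1) ->
  fps_div (qsin q) (qcos q) n =
    if odd n then qtangent q n./2 / qpoch q q n else 0.
Proof.
move=> hq; case: ifPn => n_odd.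
  have En : (2 * n./2).+1%N = n by rewrite mul2n -[RHS]odd_double_half n_odd.
  by rewrite /qtangent En mulfK // qpoch_neq0.
rewrite /fps_div /fps_mul big1 // => i _; rewrite /qsin.
case: ifPn => i_odd; last by rewrite mul0r.
have le_in : (i <= n)%N by rewrite -ltnS.
by rewrite fps_inv_qcos_odd ?mulr0 // oddB // (negbTE n_odd) i_odd.
Qed.

End Facts.

(* Main.v *)
(* Let s = sin_q, c = cos_q, t = s / c. By the q-binomial theorem the q-analogue
   of sin(2x)/2, namely S = s c / (s^2 + c^2), is
     S = sum_m (-1)^m (-q;q)_{2m} x^{2m+1} / (q;q)_{2m+1},
   whereas 1 + t^2 generates the numbers T~_{2k+1}(q); the claim is the
   coefficient of x^{2n+1} in S (1 + t^2) = t.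
   In place of the q-binomial theorem (which would bring in sqrt(-1) and a
   division by 2, unavailable in characteristic 2) we use that S, C (the
   q-analogue of cos(2x)) and s c, c^2 - s^2 solve the same q-difference system
   up to the factor s^2 + c^2, which x |-> q x multiplies by 1 + x^2.
   Power series are handled as polynomials modulo X^N. *)
Require Import Defs.
From mathcomp Require Import all_boot all_order all_algebra.
From mathcomp Require Import ring zify.
Import GRing.Theory.
Local Open Scope ring_scope.

Set Implicit Arguments.
Unset Strict Implicit.
Unset Printing Implicit Defensive.

(** * Divisibility by powers of X, and the substitution of a X for X *)

Section PowersOfX.
Variable R : idomainType.
Implicit Types (p r : {poly R}) (N n i : nat).

Lemma dvdp_XnP N p : reflect (forall i, (i < N)%N -> p`_i = 0) ('X^N %| p).
Proof.
apply: (iffP idP) => [/Pdiv.IdomainMonic.dvdpP p_XN i lt_iN | p0].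
  have [|u ->] := p_XN; first exact: monicXn.
  by rewrite coefMXn lt_iN.
rewrite -(poly_take_drop N p) [take_poly N p](_ : _ = 0).
  by rewrite add0r dvdp_mull.
by apply/polyP => i; rewrite coef_take_poly coef0; case: ifP => // /p0.
Qed.

Lemma coprimep_Xn N p : p`_0 != 0 -> coprimep 'X^N p.
Proof.
move=> p0; rewrite coprimep_sym coprimep_expr // coprimepX /root.
by rewrite horner_coef0.
Qed.

Lemma coef_comp_poly_scaleX (a : R) p n : (p \Po (a *: 'X))`_n = a ^+ n * p`_n.
Proof.
rewrite comp_polyE coef_sum.
under eq_bigr => i _ do rewrite exprZn scalerA coefZ coefXn.
have [lt_np | le_pn] := ltnP n (size p).
  rewrite (bigD1 (Ordinal lt_np)) //= eqxx mulr1 big1 ?addr0 1?mulrC // => i ne.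
  by rewrite (_ : n == i = false) ?mulr0 // eq_sym; apply: negbTE.
rewrite nth_default // mulr0 big1 // => i _.
by rewrite gtn_eqF ?mulr0 // (leq_trans (ltn_ord i)).
Qed.

End PowersOfX.

Lemma sum_even_odd (V : nmodType) (f : nat -> V) n :
  \sum_(i < 2 * n) f i = \sum_(k < n) (f (2 * k)%N + f (2 * k).+1).
Proof.
elim: n => [|n IHn]; first by rewrite !big_ord0.
by rewrite mulnS !add2n !big_ord_recr /= IHn addrA.
Qed.

(** * Power series as polynomials modulo X^N *)

Section Truncation.
Variable F : fieldType.
Implicit Types (f g : fps F) (N : nat).

Definition trunc N f : {poly F} := \poly_(i < N) f i.

Lemma coef_trunc N f i : (i < N)%N -> (trunc N f)`_i = f i.
Proof. by move=> lt_iN; rewrite coef_poly lt_iN. Qed.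

Lemma coef_truncM N f g i :
  (i < N)%N -> (trunc N f * trunc N g)`_i = fps_mul f g i.
Proof.
move=> lt_iN; rewrite coefM; apply: eq_bigr => j _.
by rewrite !coef_trunc // (leq_ltn_trans _ lt_iN) ?leq_subr // -ltnS.
Qed.

(** Truncation respects products only modulo X^N, so the error splits into that of f * (1/g) and
    that of (1/g) * g = 1. *)
Lemma trunc_fps_div N f g : g 0%N != 0 ->
  'X^N %| trunc N (fps_div f g) * trunc N g - trunc N f.
Proof.
move=> g0.
have dvd_inv : 'X^N %| trunc N (fps_inv g) * trunc N g - 1.
  apply/dvdp_XnP => i lt_iN; rewrite coefB coef_truncM // fps_mulVf // coef1.
  by rewrite subrr.
have dvd_mul :
    'X^N %| trunc N (fps_div f g) - trunc N f * trunc N (fps_inv g).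
  apply/dvdp_XnP => i lt_iN; rewrite coefB coef_truncM // coef_trunc //.
  by rewrite subrr.
rewrite (_ : _ - _ =
    (trunc N (fps_div f g) - trunc N f * trunc N (fps_inv g)) * trunc N g
    + trunc N f * (trunc N (fps_inv g) * trunc N g - 1)); last by ring.
by apply: dvdp_add; [exact: dvdp_mulr | exact: dvdp_mull].
Qed.

End Truncation.

(** * Coefficient recurrences for s, c, S and C *)

Section DoubleAngle.
Variables (F : fieldType) (q : F).
Hypothesis hq : forall i : nat, (0 < i)%N -> q ^+ i != 1.

Lemma qpochSr (t : F) m : qpoch t q m.+1 = qpoch t q m * (1 - t * q ^+ m).
Proof. by rewrite /qpoch big_ord_recr. Qed.

Lemma qpochS (t : F) m : qpoch t q m.+1 = (1 - t) * qpoch (t * q) q m.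
Proof.
rewrite /qpoch big_ord_recl expr0 mulr1; congr (_ * _).
by apply: eq_bigr => i _; rewrite /= /bump /= add1n exprS mulrA.
Qed.

Lemma onem_expr_neq0 m : 1 - q ^+ m.+1 != 0.
Proof. by rewrite subr_eq0 eq_sym hq. Qed.

(** Coefficient form of s(qx) = s(x) - x c(x); likewise [qcosS] encodes c(qx) = c(x) + x s(x). *)
Lemma qsinS n : (1 - q ^+ n.+1) * qsin q n.+1 = qcos q n.
Proof.
rewrite /qsin /qcos /=; case: (boolP (odd n)) => n_odd /=.
  by rewrite mulr0.
rewrite uphalf_half (negbTE n_odd) qpochSr -exprS; field.
by rewrite onem_expr_neq0 qpoch_neq0.
Qed.

Lemma qcosS n : (1 - q ^+ n.+1) * qcos q n.+1 = - qsin q n.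
Proof.
rewrite /qsin /qcos /=; case: (boolP (odd n)) => n_odd /=; last first.
  by rewrite mulr0 oppr0.
rewrite uphalf_half n_odd add1n qpochSr -exprS [(-1) ^+ _.+1]exprS; field.
by rewrite onem_expr_neq0 qpoch_neq0.
Qed.

(* S and C above; they are analogues of sin(2x) / 2 and cos(2x). *)
Definition qsin2 : fps F := fun n =>
  if odd n then (-1) ^+ n./2 * qpoch (- q) q n.-1 / qpoch q q n else 0.

Definition qcos2 : fps F := fun n =>
  if odd n then 0 else (-1) ^+ n./2 * qpoch (-1) q n / qpoch q q n.

(** Relates the coefficients of C to those of S. Since (-1;q)_0 = 1, the formula of [qcos2] also
    gives the right constant term. *)
Lemma qpochN1S m : qpoch (-1) q m.+1 = 2 * qpoch (- q) q m.
Proof. by rewrite qpochS opprK mulN1r. Qed.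

(** Degrees 2 and up of (1 + x^2) S(qx) = (1 - x^2) S(x) - x C(x); [qcos2SS] does this for (1 + x^2)
    C(qx) = (1 - x^2) C(x) + 4 x S(x). *)
Lemma qsin2SS n :
  (1 - q ^+ n.+2) * qsin2 n.+2 = (1 + q ^+ n) * qsin2 n + qcos2 n.+1.
Proof.
rewrite /qsin2 /qcos2 /= negbK; case: (boolP (odd n)) => n_odd /=; last first.
  by rewrite !mulr0 addr0.
case: n n_odd => // m; rewrite oddS => m_odd.
rewrite /= uphalf_half (negbTE m_odd) add0n.
rewrite qpochN1S !qpochSr -!exprS !mulNr -!exprS [(-1) ^+ _.+1]exprS; field.
by rewrite !onem_expr_neq0 qpoch_neq0.
Qed.

Lemma qcos2SS n :
  (1 - q ^+ n.+2) * qcos2 n.+2 = (1 + q ^+ n) * qcos2 n - 4 * qsin2 n.+1.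
Proof.
rewrite /qsin2 /qcos2 /= negbK; case: (boolP (odd n)) => n_odd /=.
  by rewrite !mulr0 subr0.
rewrite uphalf_half (negbTE n_odd) /= add0n.
(* As n may be 0, (-1;q)_n need not contain the factor 2; instead 2 (-q;q)_n is folded into
   (-1;q)_{n+1}. *)
have -> : 4 * ((-1) ^+ n./2 * qpoch (- q) q n / qpoch q q n.+1)
  = 2 * ((-1) ^+ n./2 * qpoch (-1) q n.+1 / qpoch q q n.+1).
  by rewrite qpochN1S; ring.
rewrite !qpochSr -!exprS !mulN1r [(-1) ^+ _.+1]exprS; field.
by rewrite !onem_expr_neq0 qpoch_neq0.
Qed.

Lemma qsin2_1 : (1 - q) * qsin2 1 = qcos2 0.
Proof.
rewrite /qsin2 /qcos2 /= /qpoch !big_ord0 big_ord1 expr0.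
by field; rewrite oner_neq0 (onem_expr_neq0 0).
Qed.

Lemma qcos0 : qcos q 0 = 1.
Proof. by rewrite /qcos /= /qpoch big_ord0 invr1 mul1r. Qed.

(** * The q-difference system modulo X^N and the double-angle formulas *)

Section Modulo.
Variable N : nat.
Let dil (p : {poly F}) := p \Po (q *: 'X).
Let s := trunc N (qsin q).
Let c := trunc N (qcos q).
Let S := trunc N qsin2.
Let C := trunc N qcos2.

Lemma dil_qsin : 'X^N %| dil s - (s - 'X * c).
Proof.
apply/dvdp_XnP => i lt_iN; rewrite !coefB coefXM coef_comp_poly_scaleX.
case: i lt_iN => [|i] lt_iN /=; rewrite !coef_trunc ?(ltnW lt_iN) //.
  by rewrite expr0; ring.
by rewrite -qsinS; ring.
Qed.

Lemma dil_qcos : 'X^N %| dil c - (c + 'X * s).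
Proof.
apply/dvdp_XnP => i lt_iN; rewrite coefB coefD coefXM coef_comp_poly_scaleX.
case: i lt_iN => [|i] lt_iN /=; rewrite !coef_trunc ?(ltnW lt_iN) //.
  by rewrite expr0; ring.
by rewrite -[qsin q i]opprK -qcosS; ring.
Qed.

Lemma dil_qsin2 :
  'X^N %| (1 + 'X^2) * dil S - ((1 - 'X^2) * S - 'X * C).
Proof.
apply/dvdp_XnP => i lt_iN.
rewrite mulrDl mulrBl !mul1r !(coefB, coefD) !coefXnM coefXM.
rewrite !coef_comp_poly_scaleX.
(* The X^2 terms start in degree 2, so degrees 0 and 1 are apart; degree 1 is [qsin2_1]. *)
case: i lt_iN => [|[|i]] lt_iN /=;
  rewrite ?subSS ?subn0 !coef_trunc ?(ltnW lt_iN) ?(ltnW (ltnW lt_iN)) //.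
- by rewrite expr0; ring.
- by rewrite -qsin2_1; ring.
- apply/eqP; rewrite -oppr_eq0; apply/eqP.
  by rewrite -[RHS](subrr ((1 - q ^+ i.+2) * qsin2 i.+2)) {2}qsin2SS; ring.
Qed.

Lemma dil_qcos2 :
  'X^N %| (1 + 'X^2) * dil C - ((1 - 'X^2) * C + 4 *: ('X * S)).
Proof.
apply/dvdp_XnP => i lt_iN.
rewrite mulrDl mulrBl !mul1r !(coefB, coefD) coefZ !coefXnM coefXM.
rewrite !coef_comp_poly_scaleX.
case: i lt_iN => [|[|i]] lt_iN /=;
  rewrite ?subSS ?subn0 !coef_trunc ?(ltnW lt_iN) ?(ltnW (ltnW lt_iN)) //.
- by rewrite expr0; ring.
- by rewrite /qsin2 /qcos2 /=; ring.
- apply/eqP; rewrite -oppr_eq0; apply/eqP.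
  by rewrite -[RHS](subrr ((1 - q ^+ i.+2) * qcos2 i.+2)) {2}qcos2SS; ring.
Qed.

(* Coefficients satisfying this system are determined, degree by degree, by
   their values in degree 0. *)
Lemma dil_system_eq0 (X Y : {poly F}) : X`_0 = 0 -> Y`_0 = 0 ->
  'X^N %| dil X - ((1 - 'X^2) * X - 'X * Y) ->
  'X^N %| dil Y - ((1 - 'X^2) * Y + 4 *: ('X * X)) ->
  'X^N %| X.
Proof.
move=> X0 Y0 /dvdp_XnP dX /dvdp_XnP dY; apply/dvdp_XnP => i.
suff H : (i < N)%N -> X`_i = 0 /\ Y`_i = 0 by move=> /H[].
have [m] := ubnP i; elim: m i => // m IHm [|i] // lt_im lt_iN.
have IH j : (j <= i)%N -> X`_j = 0 /\ Y`_j = 0.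
  by move=> le_ji; apply: IHm; [exact: leq_ltn_trans le_ji lt_im
                               | exact: leq_ltn_trans le_ji (ltnW lt_iN)].
have [Xi Yi] := IH i (leqnn i).
(* For i = 0 the X^2 term is absent; [if_same] below treats this together with i > 0. *)
have [Xj Yj] := IH i.-1 (leq_pred i).
have q1 := onem_expr_neq0 i.
(* With all lower coefficients zero, degree i+1 of the system says that 1 - q^(i+1) kills the
   coefficient. *)
split; apply: (mulfI q1); rewrite mulr0.
  have := dX _ lt_iN.
  rewrite mulrBl !mul1r !(coefB, coefD) coefXnM coefXM /= Yi.
  rewrite subSS subn1 Xj if_same coef_comp_poly_scaleX => E.
  by apply/eqP; rewrite -oppr_eq0; apply/eqP; rewrite -[RHS]E; ring.
have := dY _ lt_iN.
rewrite mulrBl !mul1r !(coefB, coefD) coefZ coefXnM coefXM /= Xi.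
rewrite subSS subn1 Yj if_same coef_comp_poly_scaleX => E.
by apply/eqP; rewrite -oppr_eq0; apply/eqP; rewrite -[RHS]E; ring.
Qed.

(** This difference and its cosine companion solve the homogeneous system with zero constant terms,
    hence vanish modulo X^N. *)
Lemma qsin2_double_angle : 'X^N %| S * (s ^+ 2 + c ^+ 2) - s * c.
Proof.
have [-> | N_gt0] := posnP N; first by rewrite expr0 dvd1p.
have dilE p : p \Po (q *: 'X) = dil p by [].
have [d1 d2] := (dil_qsin, dil_qcos).
set A1 := (X in 'X^N %| X) in d1; set A2 := (X in 'X^N %| X) in d2.
have d3 := dil_qsin2; have d4 := dil_qcos2.
set A3 := (X in 'X^N %| X) in d3; set A4 := (X in 'X^N %| X) in d4.
apply: (@dil_system_eq0 _ (C * (s ^+ 2 + c ^+ 2) - (c ^+ 2 - s ^+ 2))).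
- rewrite !(coefB, coefD, coef0M, expr2) !coef_trunc //.
  by rewrite /qsin /qsin2 /=; ring.
- rewrite !(coefB, coefD, coef0M, expr2) !coef_trunc //.
  by rewrite qcos0 /qsin /qcos2 /= /qpoch !big_ord0 invr1; ring.
(* The cofactors come from a^2 - b^2 = (a - b)(a + b) and from (s - xc)^2 + (c + xs)^2 = (1 +
   x^2)(s^2 + c^2), which brings in [A3]. *)
- rewrite [X in 'X^N %| X](_ : _ =
    A1 * (dil S * (dil s + (s - 'X * c)) - dil c)
    + A2 * (dil S * (dil c + (c + 'X * s)) - (s - 'X * c))
    + A3 * (s ^+ 2 + c ^+ 2)).
    by do 2?apply: dvdp_add; apply: dvdp_mulr.
  rewrite {1}/dil !expr2 !(comp_polyB, comp_polyD, comp_polyM) !dilE.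
  rewrite /A1 /A2 /A3.
  ring.
- rewrite [X in 'X^N %| X](_ : _ =
    A1 * (dil C * (dil s + (s - 'X * c)) + (dil s + (s - 'X * c)))
    + A2 * (dil C * (dil c + (c + 'X * s)) - (dil c + (c + 'X * s)))
    + A4 * (s ^+ 2 + c ^+ 2)).
    by do 2?apply: dvdp_add; apply: dvdp_mulr.
  rewrite {1}/dil !expr2 !(comp_polyB, comp_polyD, comp_polyM) !dilE.
  rewrite /A1 /A2 /A4.
  rewrite -!mul_polyC !rmorph_nat; ring.
Qed.

Let tg := trunc N (fps_div (qsin q) (qcos q)).

(** The previous formula divided by c^2, which is coprime to X^N because c has constant term 1. *)
Lemma qtan_double_angle : 'X^N %| S * (1 + tg ^+ 2) - tg.
Proof.
have [-> | N_gt0] := posnP N; first by rewrite expr0 dvd1p.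
have c0 : c`_0 != 0 by rewrite coef_trunc // qcos0 oner_neq0.
have dt : 'X^N %| tg * c - s by apply: trunc_fps_div; rewrite qcos0 oner_neq0.
rewrite -(Gauss_dvdpl _ (coprimep_expr 2 (coprimep_Xn N c0))).
rewrite [X in _ %| X](_ : _ = (S * (s ^+ 2 + c ^+ 2) - s * c)
   + (tg * c - s) * (S * (tg * c + s) - c)); last by ring.
by apply: dvdp_add; [exact: qsin2_double_angle | exact: dvdp_mulr].
Qed.

End Modulo.

(** * From series identities to q-tangent numbers *)

Lemma qtan_even m : fps_div (qsin q) (qcos q) (2 * m)%N = 0.
Proof. by rewrite qtangentP // mul2n odd_double. Qed.

Lemma qtan_odd m :
  fps_div (qsin q) (qcos q) (2 * m).+1%N = qtangent q m / qpoch q q (2 * m).+1.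
Proof. by rewrite qtangentP // mul2n /= odd_double uphalf_double. Qed.

(** In the square of the odd series t only products of two odd degrees survive; the added 1 accounts
    for the convention at k = 0. *)
Lemma qtangent_tilde_gf n :
  fps_mul (fps_div (qsin q) (qcos q)) (fps_div (qsin q) (qcos q)) n
    + (n == 0%N)%:R
  = if odd n then 0 else qtangent_tilde q n./2 / qpoch q q n.
Proof.
set t := fps_div _ _; rewrite /fps_mul.
have t0 i : ~~ odd i -> t i = 0.
  by move=> i_even; rewrite /t qtangentP // (negbTE i_even).
case: (boolP (odd n)) => n_odd.
  rewrite big1 ?add0r; first by case: n n_odd.
  move=> i _; have [i_odd | /t0->] := boolP (odd i); last by rewrite mul0r.
  by rewrite [t (n - i)%N]t0 ?mulr0 // oddB -1?ltnS // n_odd i_odd.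
have -> : n = (2 * n./2)%N by rewrite mul2n even_halfK.
(* The last term, i = 2k, vanishes; without it the 2k remaining terms pair up by parity. *)
move: n./2 => k; rewrite mul2n doubleK -mul2n big_ord_recr /=.
rewrite [t (2 * k)%N]qtan_even mul0r addr0.
rewrite (sum_even_odd (fun i => t i * t (2 * k - i)%N)) /qtangent_tilde.
case: k => [|k]; first by rewrite !muln0 big_ord0 add0r /qpoch big_ord0 divr1.
rewrite muln_eq0 /= addr0 mulr_suml; apply: eq_bigr => i _.
rewrite /t qtan_even mul0r add0r.
have lt_ik := ltn_ord i.
have Ek : (2 * k.+1 - (2 * i).+1 = (2 * (k.+1 - i - 1)).+1)%N by lia.
rewrite Ek !qtan_odd /qbinom Ek; field.
by rewrite !qpoch_neq0.
Qed.

Lemma qtangent_convolution n :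
  \sum_(k < n.+1) qtangent_tilde q k / qpoch q q (2 * k)
     * qsin2 (2 * n - 2 * k).+1%N
  = qtangent q n / qpoch q q (2 * n).+1.
Proof.
(* Precision 2n+2 is the least that retains the coefficient of x^(2n+1). *)
have /dvdp_XnP /(_ (2 * n).+1 (ltnSn _)) := qtan_double_angle (2 * n).+2.
rewrite coefB coef_trunc // qtan_odd => /eqP; rewrite subr_eq0 => /eqP <-.
rewrite mulrC coefM -[(2 * n).+2]/(2 + 2 * n)%N -mulnS.
set g : fps F := fun i =>
  if odd i then 0 else qtangent_tilde q i./2 / qpoch q q i.
rewrite [RHS](eq_bigr
    (fun i : 'I_(2 * n.+1) => g i * qsin2 ((2 * n).+1 - i)%N)).
  rewrite (sum_even_odd (fun i => g i * qsin2 ((2 * n).+1 - i)%N)).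
  apply: eq_bigr => k _; rewrite /g mul2n /= odd_double /= doubleK mul0r addr0.
  by rewrite -!mul2n subSn // leq_mul2l /= -ltnS ltn_ord.
move=> i _; have lt_i : (i < (2 * n).+2)%N by have := ltn_ord i; lia.
rewrite [X in _ * X]coef_trunc; last by lia.
congr (_ * _); rewrite coefD coef1 expr2 coef_truncM // addrC.
exact: qtangent_tilde_gf.
Qed.

End DoubleAngle.

Theorem theorem4p1 (F : fieldType) (q : F)
    (hq : forall i : nat, (0 < i)%N -> q ^+ i != 1) (n : nat) :
  \sum_(k < n.+1)
     (-1) ^+ k * qbinom q (2 * n).+1 (2 * k)
       * qpoch (- q) q (2 * n - 2 * k) * qtangent_tilde q k
  = (-1) ^+ n * qtangent q n.
Proof.
have pq0 m : qpoch q q m != 0 by exact: qpoch_neq0.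
have -> : qtangent q n
    = qtangent q n / qpoch q q (2 * n).+1 * qpoch q q (2 * n).+1.
  by rewrite divfK.
rewrite -qtangent_convolution // mulr_suml mulr_sumr.
apply: eq_bigr => k _; have le_kn : (k <= n)%N by rewrite -ltnS.
have Em : (2 * n - 2 * k = (n - k).*2)%N by lia.
rewrite /qsin2 /qbinom subSn ?leq_mul2l // Em /= odd_double uphalf_double /=.
(* The factor (-1)^(n-k) cancels the sign in the coefficient of S, leaving (-1)^k. *)
have -> : (-1) ^+ n = (-1) ^+ k * (-1) ^+ (n - k) :> F.
  by rewrite -exprD subnKC.
transitivity ((-1) ^+ k * ((-1) ^+ (n - k) * (-1) ^+ (n - k))
    * (qpoch q q (2 * n).+1 / (qpoch q q (n - k).*2.+1 * qpoch q q (2 * k)))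
    * qpoch (- q) q (n - k).*2 * qtangent_tilde q k).
  by rewrite -expr2 sqrr_sign mulr1.
by field; rewrite !pq0.
Qed.
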